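(* Let $X$ be a set, $p\ge 2$, $f:X\to\mathbb{R}^p$, let $Y\subseteq\mathbb{R}^p$ satisfy $f(X)\subseteq Y$, let $U$ be a set of parameters and let $g:Y\times U\to\mathbb{R}\cup\{+\infty\}$. Suppose that for each $\bar y\in Y$ and each $\delta>0$ there exists some $u\in U$ with $$\{y\in Y:\ g(y,u)<g(\bar y,u)\}\subseteq(\bar y-C_\delta).$$ Then the parametric problems $(P_u)$: $\min\{g(f(x),u): x\in X\}$, $u\in U$, generate all properly efficient solutions of $\min\{f(x):x\in X\}$; i.e., if $\hat x$ is a properly efficient solution of $\min\{f(x):x\in X\}$, then $\hat x$ is an optimal solution of $(P_u)$ for some $u\in U$.
   Context: Notation: $\mathbb{R}^p_+$ is the nonnegative orthant; $e$ is the vector of ones and $e^i$ the $i$-th unit coordinate vector in $\mathbb{R}^p$. For $\delta\in\mathbb{R}_+$, $$C_\delta=\{y\in\mathbb{R}^p:\ \langle e^i+\delta e,y\rangle\ge 0,\ i=1,\dots,p\}.$$ Proper efficiency for $\min\{f(x):x\in X\}$, $f:X\to\mathbb{R}^p$: a point $\bar x\in X$ is efficient if there is no $x\in X$ with $f_i(x)\le f_i(\bar x)$ for all $i$ and $f_j(x)<f_j(\bar x)$ for some $j$. The point $\bar x$ is properly efficient (Geoffrion) if it is efficient and there is a real $M>0$ such that for all $i\in\{1,\dots,p\}$ and $x\in X$ with $f_i(x)<f_i(\bar x)$ there is $j\in\{1,\dots,p\}$ with $f_j(x)>f_j(\bar x)$ and $\frac{f_i(\bar x)-f_i(x)}{f_j(x)-f_j(\bar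 x)}\le M$. Equivalent definitions, used interchangeably: (Benson) $\mathrm{cl}\big(\mathrm{cone}(f(X)+\mathbb{R}^p_+-f(\bar x))\big)\cap(-\mathbb{R}^p_+)=\{0\}$, where $\mathrm{cone}$ is the conic hull; (Henig) there is a convex pointed cone $C$ with $\mathbb{R}^p_+\setminus\{0\}\subseteq\mathrm{int}(C)$ and $f(X)\cap(f(\bar x)-C)=\{f(\bar x)\}$. *)

(* Defs.v *)
From mathcomp Require Import all_boot all_order all_algebra.
From mathcomp Require Import classical_sets reals constructive_ereal.

Set Implicit Arguments.
Unset Strict Implicit.
Unset Printing Implicit Defensive.

Import Order.TTheory GRing.Theory Num.Theory.

Local Open Scope ring_scope.
Local Open Scope classical_set_scope.

Definition dot (R : realType) (p : nat) (u v : 'rV[R]_p) : R :=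
  \sum_(i < p) u 0 i * v 0 i.

Definition coneC (R : realType) (p : nat) (delta : R) : set 'rV[R]_p :=
  [set y | forall i : 'I_p, 0 <= dot (delta_mx 0 i + delta *: const_mx 1) y].

Definition efficient (R : realType) (p : nat) (X : Type) (f : X -> 'rV[R]_p)
    (xbar : X) : Prop :=
  ~ exists x : X, (forall i, f x 0 i <= f xbar 0 i) /\
                  (exists j, f x 0 j < f xbar 0 j).

(* Geoffrion's definition of proper efficiency. *)
Definition properly_efficient (R : realType) (p : nat) (X : Type)
    (f : X -> 'rV[R]_p) (xbar : X) : Prop :=
  efficient f xbar /\
  exists M : R, 0 < M /\
    forall (i : 'I_p) (x : X), f x 0 i < f xbar 0 i ->
      exists j : 'I_p, f xbar 0 j < f x 0 j /\
        (f xbar 0 i - f x 0 i) / (f x 0 j - f xbar 0 j) <= M.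

(* The optimal value is allowed to be +oo. *)
Definition optimal_solution (R : realType) (X : Type) (h : X -> \bar R)
    (xhat : X) : Prop :=
  forall x : X, (h xhat <= h x)%E.

(* Main.v *)
(** If some f(x) lies in f(xhat) - C_delta with d := f(xhat) - f(x) <> 0, then
    efficiency gives d a negative entry, so the cone inequality there makes the
    sum S of the entries of d positive, and the largest entry d_i is positive
    with S <= p d_i. Geoffrion's condition at i yields j with d_j < 0 and
    d_i <= M (-d_j), while the cone inequality at j yields
    -d_j <= delta S <= delta p M (-d_j). This is impossible once delta p M < 1,
    so for such delta the parameter u supplied by the level-set hypothesis at
    f(xhat) works. *)
Require Import Defs.
From mathcomp Require Import all_boot all_order all_algebra.
From mathcomp Require Import classical_sets reals constructive_ereal.
From mathcomp Require Import lra.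

Import Order.TTheory GRing.Theory Num.Theory.

Local Open Scope ring_scope.
Local Open Scope classical_set_scope.

Lemma coneCE (R : realType) (p : nat) (delta : R) (y : 'rV[R]_p) :
  coneC delta y <-> forall i, 0 <= y 0 i + delta * \sum_j y 0 j.
Proof.
have dotE i : dot (delta_mx 0 i + delta *: const_mx 1) y =
    y 0 i + delta * \sum_j y 0 j.
  rewrite /dot (eq_bigr (fun j => (i == j)%:R * y 0 j + delta * y 0 j)); last first.
    by move=> j _; rewrite !mxE eqxx mulr1 mulrDl eq_sym.
  rewrite big_split /= -mulr_sumr (bigD1 i) //= eqxx mul1r big1 ?addr0 //.
  by move=> j /negbTE ji; rewrite eq_sym ji mul0r.
by split=> H i; move: (H i); rewrite /= dotE.
Qed.

(** A single [delta] serves every [x] because Geoffrion's bound [M] is uniform in the index and in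
    [x]. *)
Lemma properly_efficient_coneC (R : realType) (X : Type) (p : nat)
    (f : X -> 'rV[R]_p) (xhat : X) :
  properly_efficient f xhat ->
  exists2 delta : R, 0 < delta &
    forall x, coneC delta (f xhat - f x) -> f x = f xhat.
Proof.
move=> [eff [M [M0 hM]]].
have pM0 : 0 <= p%:R * M by rewrite mulr_ge0 ?ler0n // ltW.
(* The summand 1 keeps the inverse positive and makes delta p M < 1 strict. *)
exists (p%:R * M + 1)^-1; first by rewrite invr_gt0 ltr_wpDl.
set delta := (_)^-1 => x /coneCE cone; set S := \sum_j _ in cone.
have delta0 : 0 < delta by rewrite invr_gt0 ltr_wpDl.
(* If no entry of d is negative, a positive one would make [x] dominate [xhat], so d = 0. *)
have [/forallP dge0|] := boolP [forall j, f x 0 j <= f xhat 0 j].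
  apply/rowP => j; apply/eqP; rewrite eq_le dge0 leNgt.
  by apply/negP => dj; apply: eff; exists x; split => //; exists j.
rewrite negb_forall => /existsP[k]; rewrite -ltNge => dk.
have S0 : 0 < S.
  rewrite -(pmulr_rgt0 _ delta0); move: (cone k); rewrite !mxE; lra.
pose d i := f xhat 0 i - f x 0 i.
(* Here [k] only witnesses that there is an index to maximize over. *)
have [i _ imax] := @arg_maxP _ _ _ k xpredT d isT.
have SE : S = \sum_j d j by apply: eq_bigr => j _; rewrite !mxE.
have Sle : S <= p%:R * d i.
  rewrite SE mulr_natl -[X in _ *+ X](card_ord p) -sumr_const.
  by apply: ler_sum => j _; exact: imax.
have di : 0 < d i.
  rewrite ltNge; apply/negP => di0.
  by move: (lt_le_trans S0 Sle); rewrite ltNge mulr_ge0_le0 ?ler0n.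
have [|j [dj]] := hM i x; first by rewrite -subr_gt0.
rewrite ler_pdivrMr ?subr_gt0 // -/(d i) => dij.
have SM : S <= p%:R * M * (f x 0 j - f xhat 0 j).
  by rewrite -mulrA (le_trans Sle) // ler_wpM2l ?ler0n.
have : f x 0 j - f xhat 0 j <= S * delta.
  move: (cone j); rewrite !mxE mulrC; lra.
(* Clearing the inverse gives (-d_j) (p M + 1) <= S, which with [SM] forces -d_j <= 0, against
   [dj]. *)
rewrite ler_pdivlMr ?ltr_wpDl // mulrDr mulr1 [_ * (_ * _)]mulrC => dS.
by exfalso; move: dj SM dS; lra.
Qed.

Theorem theorem3p2 (R : realType) (X : Type) (p : nat) (hp : (2 <= p)%N)
    (f : X -> 'rV[R]_p) (Y : set 'rV[R]_p) (hfY : range f `<=` Y)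
    (U : Type) (g : 'rV[R]_p -> U -> \bar R)
    (hg : forall y : 'rV[R]_p, Y y -> forall u : U, g y u <> -oo%E)
    (hlevel : forall ybar : 'rV[R]_p, Y ybar ->
      forall delta : R, 0 < delta ->
      exists u : U,
        [set y | Y y /\ (g y u < g ybar u)%E] `<=`
        [set ybar - c | c in coneC delta]) :
  forall xhat : X, properly_efficient f xhat ->
    exists u : U, optimal_solution (fun x => g (f x) u) xhat.
Proof.
move=> xhat pe.
have [delta delta0 hdelta] := properly_efficient_coneC _ _ _ _ _ pe.
have fY x : Y (f x) by apply: hfY; exists x.
have [u hu] := hlevel _ (fY xhat) _ delta0.
exists u => x; rewrite leNgt; apply/negP => glt.
have [c cC fxE] := hu _ (conj (fY x) glt).
have fxx : f x = f xhat by apply: hdelta; rewrite -fxE subKr.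
by move: glt; rewrite fxx ltxx.
Qed.
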